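(* Let $P,Q$ be probability measures on a measurable space $(\Omega,\Sigma)$, both absolutely continuous with respect to a measure $\lambda$. Every point $(\alpha,\beta)$ of the Neyman-Pearson region of $(P,Q)$ satisfies $$\beta\ln\!\left(\frac{\beta}{1-\alpha}\right)+(1-\beta)\ln\!\left(\frac{1-\beta}{\alpha}\right)\le \mathrm{KL}(P\|Q).\qquad (1)$$ This bound is tighter than the bound $$\alpha+\beta\ge 1-\sqrt{\tfrac12\,\mathrm{KL}(P\|Q)}\qquad(2)$$ derived from Pinsker's inequality (which is trivial when $\mathrm{KL}(P\|Q)\ge2$), in the sense that every $(\alpha,\beta)\in[0,1]\times[0,1]$ satisfying (1) also satisfies (2).
   Context: $\mathrm{KL}(P\|Q)\in[0,+\infty]$ is the Kullback-Leibler divergence, $\mathrm{KL}(P\|Q)=\int p\ln(p/q)\,d\lambda$ with $p,q$ the densities of $P,Q$ (it is $+\infty$ if $P$ is not absolutely continuous with respect to $Q$). Conventions: $0\ln(0/a)=0$ for $a\ge 0$ and $b\ln(b/0)=+\infty$ for $b>0$. Tests: the hypotheses are $H_0$: $x$ is a sample from $Q$, and $H_1$: $x$ is a sample from $P$. A (possibly randomized) test is a measurable $\phi:\Omega\to[0,1]$, accepting $H_0$ with probability $\phi(x)$ and $H_1$ with probability $1-\phi(x)$; its false positive rate is $\alpha=\int(1-\phi)\,dQ$ and its false negative rate is $\beta=\int\phi\,dP$. The Neyman-Pearson region is the set of all $(\alpha,\beta)$ attained by tests. *)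

(* Defs.v *)
From HB Require Import structures.
From mathcomp Require Import all_boot all_order all_algebra.
From mathcomp Require Import all_classical all_reals all_analysis.

Set Implicit Arguments.
Unset Strict Implicit.
Unset Printing Implicit Defensive.

Import Order.TTheory GRing.Theory Num.Theory.
Import numFieldNormedType.Exports.

Local Open Scope classical_set_scope.
Local Open Scope ring_scope.
Local Open Scope ereal_scope.

(* b * ln (b / a) for a, b >= 0, with the conventions 0 * ln (0 / a) = 0 and
   b * ln (b / 0) = +oo for b > 0.  It never takes the value -oo, so sums of
   such terms are unambiguous. *)
Definition xlnxdivy (R : realType) (b a : R) : \bar R :=
  if b == 0%R then 0 else if a == 0%R then +oo else (b * ln (b / a))%:E.

Definition is_density d (T : measurableType d) (R : realType)
    (lambda : {measure set T -> \bar R}) (mu : {measure set T -> \bar R})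
    (f : T -> R) : Prop :=
  [/\ measurable_fun [set: T] f, (forall x, (0 <= f x)%R) &
      forall A, measurable A -> mu A = \int[lambda]_(x in A) (f x)%:E].

(* KL(P || Q) when p and q are densities of P and Q with respect to lambda.
   The negative part of the integrand is at most q, hence integrable, so the
   integral always makes sense in ]-oo, +oo]. *)
Definition KL d (T : measurableType d) (R : realType)
    (lambda : {measure set T -> \bar R}) (P Q : probability T R)
    (p q : T -> R) : \bar R :=
  if `[< P `<< Q >] then \int[lambda]_x xlnxdivy (p x) (q x) else +oo.

(* phi x is the probability of accepting H0 (x is a sample from Q). *)
Definition is_test d (T : measurableType d) (R : realType) (phi : T -> R) :
    Prop :=
  measurable_fun [set: T] phi /\ forall x, (0 <= phi x <= 1)%R.

Definition false_positive_rate d (T : measurableType d) (R : realType)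
    (Q : probability T R) (phi : T -> R) : R :=
  (\int[Q]_x (1 - phi x))%R.

Definition false_negative_rate d (T : measurableType d) (R : realType)
    (P : probability T R) (phi : T -> R) : R :=
  (\int[P]_x phi x)%R.

Definition NP_region d (T : measurableType d) (R : realType)
    (P Q : probability T R) : set (R * R) :=
  [set ab | exists phi : T -> R, [/\ is_test phi,
     ab.1 = false_positive_rate Q phi & ab.2 = false_negative_rate P phi]].

Definition KL_bound (R : realType) (kl : \bar R) (alpha beta : R) : Prop :=
  xlnxdivy beta (1 - alpha) + xlnxdivy (1 - beta) alpha <= kl.

(* The right-hand side is -oo when kl = +oo. *)
Definition Pinsker_bound (R : realType) (kl : \bar R) (alpha beta : R) : Prop :=
  1 - sqrte ((2^-1)%:E * kl) <= (alpha + beta)%:E.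

(* Main.v *)
Require Import Defs.
From HB Require Import structures.
From mathcomp Require Import all_boot all_order all_algebra.
From mathcomp Require Import all_classical all_reals all_analysis.
From mathcomp Require Import measurable_realfun.
From mathcomp Require Import ring lra.

Set Implicit Arguments.
Unset Strict Implicit.
Unset Printing Implicit Defensive.

Import Order.TTheory GRing.Theory Num.Theory.
Import numFieldNormedType.Exports.

Local Open Scope classical_set_scope.
Local Open Scope ring_scope.

(** Write D(b, a) for b ln (b / a).

    The Neyman-Pearson bound is the data-processing inequality for the
    two-valued outcome of the test.  By the tangent inequality ln x <= x - 1,
    every c > 0 gives an affine minorant of D,
      b (ln c + 1) - c a <= D(b, a)
    ([xlnxdivy_ge_tangent]), and D is the supremum of these minorants, the
    values 0 and +oo on the boundary included ([xlnxdivy_le_tangents]).  Given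
    a test phi, use at each point x the minorant of slope c1 with weight phi x
    and the one of slope c2 with weight 1 - phi x.  The weighted sum lies below
    D(p x, q x) and its integral only involves the error rates of phi
    ([KL_integral_ge_tangents]).  Taking the suprema over c1 and c2 after
    integrating gives the bound ([KL_bound_test]).

    The comparison with Pinsker's bound is Pinsker's inequality for Bernoulli
    laws, 2 (1 - alpha - beta) ^ 2 <= KL ([KL_bound_sqr]).  It follows from the
    refinement of the tangent inequality
      D(b, a) >= b - a + 3/2 (b - a) ^ 2 / (b + 2 a)
    ([xlnxdivy_ge_quadratic]), applied to (beta, 1 - alpha) and to
    (1 - beta, alpha): the linear terms cancel, the two denominators add up to
    3, and 1 / s + 1 / (3 - s) >= 4 / 3.  The refinement itself is a rational
    upper bound of the logarithm ([ln_le_pade]).  The same sufficient condition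
    for Pinsker's bound ([Pinsker_bound_of_sqr]) shows that it holds trivially
    when the divergence is at least 2, as |1 - alpha - beta| <= 1. *)

(** * Affine minorants of b ln (b / a) *)

(** This is ln x <= x - 1 at x = c a / b, with equality when c = b / a. *)
Lemma xlnxdivy_ge_tangent (R : realType) (b a c : R) :
  0 <= b -> 0 <= a -> 0 < c ->
  ((b * (ln c + 1) - c * a)%:E <= xlnxdivy b a)%E.
Proof.
move=> b0 a0 c0; rewrite /xlnxdivy.
have [->|bn0] := eqVneq b 0; first by rewrite lee_fin mul0r sub0r oppr_le0; nra.
have [_|an0] := eqVneq a 0; first exact: leey.
have bp : 0 < b by rewrite lt0r bn0.
have ap : 0 < a by rewrite lt0r an0.
have cab : 0 < c * a / b by rewrite divr_gt0 ?mulr_gt0.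
have : ln (c * a / b) <= c * a / b - 1.
  have := @le_ln1Dx _ (c * a / b - 1); rewrite [1 + _]addrC subrK; apply; lra.
rewrite !ln_div ?lnM ?posrE ?mulr_gt0// lee_fin => H.
have := ler_wpM2l b0 H.
have -> : b * (c * a / b - 1) = c * a - b by field.
by lra.
Qed.

(** The affine minorants determine b ln (b / a): the slope c = b / a is optimal
    in the interior, while on the boundary the supremum is approached as c
    tends to 0 (when b = 0) or to infinity (when a = 0 < b). *)
Lemma xlnxdivy_le_tangents (R : realType) (b a : R) (y : \bar R) :
  0 <= b -> 0 <= a ->
  (forall c, 0 < c -> ((b * (ln c + 1) - c * a)%:E <= y)%E) ->
  (xlnxdivy b a <= y)%E.
Proof.
move=> b0 a0 H; rewrite /xlnxdivy.
have [b_eq0|bn0] := eqVneq b 0.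
  have [a_eq0|an0] := eqVneq a 0.
    by have := H 1 ltr01; rewrite b_eq0 a_eq0 mul0r mulr0 subr0.
  apply/lee_subgt0Pr => e e0.
  have ap : 0 < a by rewrite lt0r an0.
  have := H (e / a) (divr_gt0 e0 ap).
  by rewrite b_eq0 mul0r -mulrA mulVf// mulr1 sub0r add0e.
have bp : 0 < b by rewrite lt0r bn0.
have [a_eq0|an0] := eqVneq a 0.
  rewrite leye_eq; apply/eqP/eqyP => r r0.
  (* The slope whose minorant takes the value r. *)
  have := H (expR (r / b - 1)) (expR_gt0 _).
  by rewrite expRK a_eq0 mulr0 subr0 subrK mulrCA divff// mulr1.
have ap : 0 < a by rewrite lt0r an0.
have := H (b / a) (divr_gt0 bp ap).
by rewrite -mulrA mulVf// mulrDr !mulr1 addrK.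
Qed.

(** * Binary Pinsker inequality *)

(** The difference of the two sides vanishes at 1 and has derivative
    (y - 1) ^ 3 / (y (2 y + 1) ^ 2), so it is minimal at 1. *)
Lemma ln_le_pade (R : realType) (y : R) : 0 < y ->
  ln y <= (y - 1) * (y + 5) / (2 * (2 * y + 1)).
Proof.
move=> y0.
pose f (x : R) := (x - 1) * (x + 5) / (2 * (2 * x + 1)) - ln x.
pose df (x : R) := (x - 1) ^+ 3 / (x * (2 * x + 1) ^+ 2).
have f1 : f 1 = 0 by rewrite /f ln1 subrr !mul0r subr0.
have fd (x : R) : 0 < x -> is_derive x 1 f (df x).
  move=> x0.
  have x1 : 2 * (2 * x + 1) != 0 by rewrite lt0r_neq0//; lra.
  have lnx := is_derive1_ln x0.
  have xI : is_derive x 1 (fun x : R => (2 * (2 * x + 1))^-1)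
      (- (2 * (2 * x + 1)) ^- 2 *: (4 : R)).
    apply: is_deriveV => //.
    by apply: is_derive_eq; rewrite /GRing.scale/=; ring.
  apply: is_derive_eq.
  rewrite /df /GRing.scale/=; field.
  by apply/andP; split; rewrite lt0r_neq0//; lra.
have fc (a b : R) : 0 < a -> {within `[a, b], continuous f}.
  move=> a0; apply: derivable_within_continuous => x.
  rewrite in_itv/= => /andP[ax _].
  by have [] := fd x (lt_le_trans a0 ax).
have dfE (x : R) : 0 < x -> exists2 k, 0 <= k & df x = (x - 1) * k.
  move=> x0; exists ((x - 1) ^+ 2 / (x * (2 * x + 1) ^+ 2)).
    by rewrite divr_ge0 ?sqr_ge0// mulr_ge0 ?sqr_ge0// ltW.
  by rewrite /df exprS mulrA.
suff : 0 <= f y by rewrite subr_ge0.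
have [y1|y1|->] := ltgtP y 1; last by rewrite f1.
- have [|c] := @MVT _ f df y 1 y1 _ (fc y 1 y0).
    by move=> x; rewrite in_itv/= => /andP[yx _]; apply: fd; lra.
  rewrite in_itv/= => /andP[yc c1]; have [|k k0 ->] := dfE c; first lra.
  rewrite f1 => e; have -> : f y = k * ((1 - c) * (1 - y)) by nra.
  by rewrite !mulr_ge0//; lra.
- have [|c] := @MVT _ f df 1 y y1 _ (fc 1 y ltr01).
    by move=> x; rewrite in_itv/= => /andP[yx _]; apply: fd; lra.
  rewrite in_itv/= => /andP[yc c1]; have [|k k0 ->] := dfE c; first lra.
  rewrite f1 => e; have -> : f y = k * ((c - 1) * (y - 1)) by nra.
  by rewrite !mulr_ge0//; lra.
Qed.

(** The bound [ln_le_pade] at y = a / b. Compared with [xlnxdivy_ge_tangent] at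
    slope c = 1, it keeps a quadratic term whose denominator is linear in
    (b, a), so that denominators can be added up.  When a = b = 0 the quotient
    below is 0 / 0 = 0. *)
Lemma xlnxdivy_ge_quadratic (R : realType) (b a : R) : 0 <= b -> 0 <= a ->
  ((b - a + 3 / 2 * (b - a) ^+ 2 / (b + 2 * a))%:E <= xlnxdivy b a)%E.
Proof.
move=> b0 a0; rewrite /xlnxdivy.
have [->|bn0] := eqVneq b 0.
  have [->|an0] := eqVneq a 0; rewrite lee_fin.
    by rewrite subrr expr0n/= mulr0 mul0r addr0.
  rewrite [leLHS](_ : _ = - a / 4); first by lra.
  by field.
have [_|an0] := eqVneq a 0; first exact: leey.
have bp : 0 < b by rewrite lt0r bn0.
have ap : 0 < a by rewrite lt0r an0.
have := ler_wpM2l b0 (ln_le_pade (divr_gt0 ap bp)).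
rewrite !ln_div ?posrE// lee_fin => H.
rewrite -lerN2 -mulrN opprB (le_trans H)// le_eqVlt; apply/orP; left.
apply/eqP; field.
by rewrite bn0 andbT lt0r_neq0//; lra.
Qed.

Lemma KL_bound_sqr (R : realType) (kl : \bar R) (alpha beta : R) :
  0 <= alpha <= 1 -> 0 <= beta <= 1 -> KL_bound kl alpha beta ->
  ((2 * (1 - alpha - beta) ^+ 2)%:E <= kl)%E.
Proof.
move=> /andP[a0 a1] /andP[b0 b1]; apply: le_trans.
have na0 : 0 <= 1 - alpha by rewrite subr_ge0.
have nb0 : 0 <= 1 - beta by rewrite subr_ge0.
(* The two linear terms below are opposite. *)
apply: le_trans (leeD (xlnxdivy_ge_quadratic b0 na0)
  (xlnxdivy_ge_quadratic nb0 a0)).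
rewrite -EFinD lee_fin.
(* Off this diagonal neither denominator vanishes. *)
have [ab|ab] := eqVneq beta (1 - alpha).
  have -> : 1 - alpha - beta = 0 by lra.
  have -> : 1 - beta - alpha = 0 by lra.
  by rewrite ab subrr expr0n/= !(mulr0, mul0r, addr0).
set s := beta + 2 * (1 - alpha).
have -> : 1 - beta + 2 * alpha = 3 - s by rewrite /s; lra.
have s0 : 0 < s by rewrite lt0r; apply/andP; split; [apply/eqP|]; rewrite /s;
  move/eqP : ab; lra.
have s3 : 0 < 3 - s by rewrite lt0r; apply/andP; split; [apply/eqP|]; rewrite /s;
  move/eqP : ab; lra.
(* The excess over 2 (1 - alpha - beta) ^ 2 is the gap in
   1 / s + 1 / (3 - s) >= 4 / 3, which is a multiple of (s - 3 / 2) ^ 2. *)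
have -> : beta - (1 - alpha) + 3 / 2 * (beta - (1 - alpha)) ^+ 2 / s +
   (1 - beta - alpha + 3 / 2 * (1 - beta - alpha) ^+ 2 / (3 - s)) =
   2 * (1 - alpha - beta) ^+ 2 +
     (1 - alpha - beta) ^+ 2 * (2 * (s - 3 / 2) ^+ 2 / (s * (3 - s))).
  by field; apply/andP; split; rewrite lt0r_neq0.
rewrite lerDl mulr_ge0 ?sqr_ge0// divr_ge0//.
  by rewrite mulr_ge0 ?sqr_ge0.
by rewrite mulr_ge0// ltW.
Qed.

(** Pinsker's bound is the square root of this inequality.  When kl = +oo its
    right-hand side is -oo. *)
Lemma Pinsker_bound_of_sqr (R : realType) (kl : \bar R) (alpha beta : R) :
  ((2 * (1 - alpha - beta) ^+ 2)%:E <= kl)%E -> Pinsker_bound kl alpha beta.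
Proof.
rewrite /Pinsker_bound; case: kl => [k| |]//=; last first.
  by rewrite mulry gtr0_sg ?invr_gt0// mul1e/= leNye.
rewrite !lee_fin => H.
suff : 1 - alpha - beta <= Num.sqrt (2^-1 * k) by lra.
apply: le_trans (ler_norm _) _.
have sq := sqr_ge0 (1 - alpha - beta).
by rewrite -sqrtr_sqr ler_sqrt; lra.
Qed.

(** * Integration against a density *)

Lemma measurable_xlnxdivy d (T : measurableType d) (R : realType)
    (p q : T -> R) :
  measurable_fun setT p -> measurable_fun setT q ->
  (forall x, 0 <= p x) -> (forall x, 0 <= q x) ->
  measurable_fun setT ((fun x => xlnxdivy (p x) (q x)) : T -> \bar R).
Proof.
move=> mp mq p0 q0.
(* Replacing ln (p / q) by ln p - ln q avoids measurability of a quotient; the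
   two agree where neither p nor q vanishes. *)
rewrite (_ : (fun x => _) = fun x => if p x == 0 then 0%E else
    if q x == 0 then +oo%E else (p x * (ln (p x) - ln (q x)))%:E).
  apply: measurable_fun_ifT => //; first exact: measurable_fun_eqr.
  apply: measurable_fun_ifT => //; first exact: measurable_fun_eqr.
  apply/measurable_EFinP/measurable_funM => //.
  by apply: measurable_funB; exact: measurableT_comp.
apply/funext => x; rewrite /xlnxdivy.
case: eqVneq => // px; case: eqVneq => // qx.
by rewrite ln_div// posrE lt0r ?px ?qx ?p0 ?q0.
Qed.

Import HBNNSimple.

(** As lambda may fail to be sigma-finite, this does not go through a
    Radon-Nikodym derivative: the definition of a density gives the formula on
    simple functions, and monotone convergence extends it. *)
Lemma integral_density d (T : measurableType d) (R : realType)
    (lambda mu : {measure set T -> \bar R}) (f h : T -> R) :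
  is_density lambda mu f -> measurable_fun setT h -> (forall x, 0 <= h x) ->
  (\int[lambda]_x (h x * f x)%:E = \int[mu]_x (h x)%:E)%E.
Proof.
move=> [mf f0 muE] mh h0.
have mhE : measurable_fun setT (EFin \o h) by exact/measurable_EFinP.
pose s := nnsfun_approx measurableT mhE.
have s_cvg x : (EFin \o s^~ x) n @[n --> \oo] --> (h x)%:E.
  by apply: (@cvg_nnsfun_approx _ _ _ _ measurableT _ mhE) => // y _;
    rewrite lee_fin.
have s_nd x : {homo (fun n => s n x) : m n / (m <= n)%N >-> m <= n}.
  by move=> m n mn; exact/lefP/nd_nnsfun_approx.
have ms n : measurable_fun setT (EFin \o s n) by exact/measurable_EFinP.
transitivity (limn (fun n => \int[lambda]_x (s n x * f x)%:E)%E).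
  rewrite -monotone_convergence//.
  - apply: eq_integral => x _; apply/esym/cvg_lim => //.
    under eq_fun do rewrite EFinM.
    by rewrite EFinM; apply: cvgeZr => //; exact: s_cvg.
  - by move=> n; apply/measurable_EFinP/measurable_funM.
  - by move=> n x _; rewrite lee_fin mulr_ge0.
  - by move=> x _ m n mn; rewrite lee_fin ler_wpM2r// s_nd.
transitivity (limn (fun n => \int[mu]_x (s n x)%:E)%E); last first.
  rewrite -monotone_convergence//.
  - by apply: eq_integral => x _; apply/cvg_lim => //; exact: s_cvg.
  - by move=> n x _; rewrite lee_fin.
  - by move=> x _ m n mn; rewrite lee_fin s_nd.
(* It remains to compare the integrals of one simple function, level set by
   level set. *)
congr (limn _); apply/funext => n.
rewrite integral_nnsfun// patch_setT sintegralE.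
transitivity (\int[lambda]_x
    (\sum_(y \in range (s n)) (y * (\1_(s n @^-1` [set y]) x * f x))%:E))%E.
  apply: eq_integral => x _.
  rewrite fsumEFin// [in LHS]fimfunE mulr_fsuml; congr EFin.
  by apply: eq_fsbigr => y _; rewrite mulrA.
rewrite ge0_integral_fsum//; last 2 first.
  - move=> y; apply/measurable_EFinP/measurable_funM => //.
    by apply: measurable_funM.
  - move=> y x _; rewrite mulrA EFinM mule_ge0 ?lee_fin//.
    by exact: (nnfun_muleindic_ge0 (s n) y x).
apply: eq_fsbigr => y; rewrite inE => -[x _ <-].
under eq_integral do rewrite EFinM.
rewrite ge0_integralZl//; last 3 first.
  - by apply/measurable_EFinP/measurable_funM.
  - by move=> z _; rewrite lee_fin mulr_ge0.
  - by rewrite lee_fin.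
rewrite muE//; congr (_ * _)%E.
rewrite [RHS]integral_mkcond.
apply: eq_integral => z _.
by rewrite patchE indicE; case: ifPn; rewrite ?mul1r ?mul0r.
Qed.

(** Only the lower function need be integrable: the integral of the upper one may be
    +oo, as a divergence can be.  Positive and negative parts are compared
    separately. *)
Lemma ge_integrable_integral d (T : measurableType d) (R : realType)
    (mu : {measure set T -> \bar R}) (f g : T -> \bar R) :
  mu.-integrable setT g -> measurable_fun setT f ->
  (forall x, (g x <= f x)%E) ->
  (\int[mu]_x g x <= \int[mu]_x f x)%E.
Proof.
move=> ig mf gf.
have mg := measurable_int _ ig.
rewrite integralE [leRHS]integralE leeB//; apply: ge0_le_integral => //.
- exact: measurable_funepos.
- exact: measurable_funepos.
- by move=> x _; apply: (@funepos_le _ _ setT) => //; rewrite ?inE// => y _.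
- exact: measurable_funeneg.
- exact: measurable_funeneg.
- by move=> x _; apply: (@funeneg_le _ _ setT) => //; rewrite ?inE// => y _.
Qed.

(** * Error rates of tests *)

Lemma bounded_test d (T : measurableType d) (R : realType) (phi : T -> R) :
  is_test phi -> [bounded phi x | x in [set: T]].
Proof.
move=> [_ phi01]; exists 1; split => // M M1 x _ /=.
by have /andP[h0 h1] := phi01 x; rewrite ger0_norm//; lra.
Qed.

Lemma is_testC d (T : measurableType d) (R : realType) (phi : T -> R) :
  is_test phi -> is_test (fun x => 1 - phi x).
Proof.
move=> [mphi phi01]; split; first exact: measurable_funB.
by move=> x; have := phi01 x; lra.
Qed.

Lemma integrable_test d (T : measurableType d) (R : realType)
    (P : probability T R) (phi : T -> R) :
  is_test phi -> P.-integrable setT (EFin \o phi).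
Proof.
move=> tphi; apply: measurable_bounded_integrable => //.
- exact: le_lt_trans (probability_le1 P measurableT) (ltry 1).
- by case: tphi.
- exact: bounded_test.
Qed.

Lemma Rintegral_testC d (T : measurableType d) (R : realType)
    (P : probability T R) (phi : T -> R) :
  is_test phi -> \int[P]_x (1 - phi x) = 1 - \int[P]_x phi x.
Proof.
move=> tphi; rewrite RintegralB//.
- rewrite Rintegral_cst// mul1r.
  by have := @probability_setT _ _ _ P => /= ->.
- exact: finite_measure_integrable_cst.
- exact: integrable_test.
Qed.

Lemma integrable_density_test d (T : measurableType d) (R : realType)
    (lambda : {measure set T -> \bar R}) (P : probability T R)
    (p phi : T -> R) :
  is_density lambda P p -> is_test phi ->
  lambda.-integrable setT (EFin \o (fun x => phi x * p x)).
Proof.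
move=> p_density phi_test.
have [mp p0 _] := p_density; have [mphi phi01] := phi_test.
have phi0 x : 0 <= phi x by case/andP: (phi01 x).
apply/integrableP; split; first exact/measurable_EFinP/measurable_funM.
under eq_integral do rewrite /= ger0_norm ?mulr_ge0//.
rewrite (integral_density p_density)//.
have /integrable_fin_num := integrable_test P phi_test.
by rewrite fin_numE => /(_ measurableT)/andP[_]; rewrite ltey.
Qed.

Lemma Rintegral_density_test d (T : measurableType d) (R : realType)
    (lambda : {measure set T -> \bar R}) (P : probability T R)
    (p phi : T -> R) :
  is_density lambda P p -> is_test phi ->
  \int[lambda]_x (phi x * p x) = \int[P]_x phi x.
Proof.
move=> p_density [mphi phi01]; congr fine; apply: integral_density => // x.
by case/andP: (phi01 x).
Qed.

(** * Data processing *)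

(** Each side of the test contributes one affine minorant of the integrand, and
    p x ln (p x / q x) dominates their average with weights phi x and
    1 - phi x. *)
Lemma KL_integral_ge_tangents d (T : measurableType d) (R : realType)
    (lambda : {measure set T -> \bar R}) (P Q : probability T R)
    (p q phi : T -> R) (c1 c2 : R) :
  is_density lambda P p -> is_density lambda Q q -> is_test phi ->
  0 < c1 -> 0 < c2 ->
  ((\int[P]_x phi x * (ln c1 + 1) - c1 * \int[Q]_x phi x)%:E +
   (\int[P]_x (1 - phi x) * (ln c2 + 1) - c2 * \int[Q]_x (1 - phi x))%:E <=
   \int[lambda]_x xlnxdivy (p x) (q x))%E.
Proof.
move=> p_density q_density phi_test c1_gt0 c2_gt0.
pose w (psi : T -> R) (c : R) (x : T) :=
  (ln c + 1) * (psi x * p x) + - c * (psi x * q x).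
have w_int psi c : is_test psi -> lambda.-integrable setT (EFin \o w psi c).
  move=> tpsi; exact: (integrableD measurableT
    (integrableZl measurableT _ (integrable_density_test p_density tpsi))
    (integrableZl measurableT _ (integrable_density_test q_density tpsi))).
have w_val psi c : is_test psi -> \int[lambda]_x w psi c x =
    \int[P]_x psi x * (ln c + 1) - c * \int[Q]_x psi x.
  move=> tpsi.
  have ip := integrable_density_test p_density tpsi.
  have iq := integrable_density_test q_density tpsi.
  rewrite (RintegralD measurableT (integrableZl measurableT (ln c + 1) ip)
    (integrableZl measurableT (- c) iq)).
  rewrite !RintegralZl// (Rintegral_density_test p_density)//.
  by rewrite (Rintegral_density_test q_density)// mulNr mulrC.
have phiC_test := is_testC phi_test.
have w_sum_int := integrableD measurableT (w_int phi c1 phi_test)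
  (w_int _ c2 phiC_test).
rewrite -EFinD -w_val// -(w_val _ c2)// -RintegralD//; try exact: w_int.
rewrite /Rintegral fineK; last exact: integrable_fin_num w_sum_int.
have [mp p0 _] := p_density; have [mq q0 _] := q_density.
apply: ge_integrable_integral; [exact: w_sum_int|exact: measurable_xlnxdivy|].
move=> x; have /andP[phi0 phi1] := phi_test.2 x.
have := xlnxdivy_ge_tangent (p0 x) (q0 x) c2_gt0.
have := xlnxdivy_ge_tangent (p0 x) (q0 x) c1_gt0.
case: (xlnxdivy _ _) => [r| |]//; first last.
  by move=> _ _; exact: leey.
rewrite !lee_fin => h1 h2; rewrite /w.
have {}phi1 : 0 <= 1 - phi x by lra.
have := ler_wpM2l phi0 h1; have := ler_wpM2l phi1 h2; lra.
Qed.

(** The two slopes in [KL_integral_ge_tangents] are independent, so each affine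
    minorant can be replaced by its supremum, one after the other. *)
Lemma KL_bound_test d (T : measurableType d) (R : realType)
    (lambda : {measure set T -> \bar R}) (P Q : probability T R)
    (p q phi : T -> R) :
  is_density lambda P p -> is_density lambda Q q -> is_test phi ->
  KL_bound (\int[lambda]_x xlnxdivy (p x) (q x))
    (false_positive_rate Q phi) (false_negative_rate P phi).
Proof.
move=> p_density q_density phi_test; rewrite /KL_bound.
rewrite /false_positive_rate /false_negative_rate.
have phiC_test := is_testC phi_test.
have -> : 1 - \int[Q]_x (1 - phi x) = \int[Q]_x phi x.
  by rewrite Rintegral_testC// subKr.
rewrite -Rintegral_testC//.
have tangents c1 c2 := @KL_integral_ge_tangents _ _ _ _ _ _ _ _ _ c1 c2
  p_density q_density phi_test.
have ge0 (mu : probability T R) psi : is_test psi -> 0 <= \int[mu]_x psi x.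
  by move=> [_ psi01]; apply: Rintegral_ge0 => x _; case/andP: (psi01 x).
set I := (\int[lambda]_x _)%E in tangents *.
(* First supremum, over the slope attached to acceptance of H0, the other slope
   being fixed: the term moved to the right is a real number. *)
have le1 c : 0 < c -> (xlnxdivy (\int[P]_x phi x) (\int[Q]_x phi x) <=
    I - (\int[P]_x (1 - phi x) * (ln c + 1) - c * \int[Q]_x (1 - phi x))%:E)%E.
  move=> c_gt0; apply: xlnxdivy_le_tangents; rewrite ?ge0// => c1 c1_gt0.
  by rewrite leeBrDr// tangents.
(* The first supremum must be finite before it can be moved to the right; if it
   is +oo then so is the integral. *)
case E : (xlnxdivy (\int[P]_x phi x) _) le1 => [r| |]// le1.
- rewrite addeC -leeBrDr//; apply: xlnxdivy_le_tangents; rewrite ?ge0// => c c0.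
  by rewrite leeBrDr// addeC -leeBrDr// le1.
- have := le1 1 ltr01; rewrite leye_eq.
  by case: I {tangents le1} => [s| |]//; rewrite leey.
- by rewrite addNye leNye.
Qed.

Theorem mainTheorem3 (R : realType) (d : measure_display)
    (T : measurableType d) (lambda : {measure set T -> \bar R})
    (P Q : probability T R) (p q : T -> R)
    (P_lambda : P `<< lambda) (Q_lambda : Q `<< lambda)
    (p_density : is_density lambda P p) (q_density : is_density lambda Q q) :
  [/\ forall alpha beta : R, NP_region P Q (alpha, beta) ->
        KL_bound (KL lambda P Q p q) alpha beta,
      forall alpha beta : R, 0 <= alpha <= 1 -> 0 <= beta <= 1 ->
        KL_bound (KL lambda P Q p q) alpha beta ->
        Pinsker_bound (KL lambda P Q p q) alpha beta &
      (2%:E <= KL lambda P Q p q)%E ->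
        forall alpha beta : R, 0 <= alpha <= 1 -> 0 <= beta <= 1 ->
          Pinsker_bound (KL lambda P Q p q) alpha beta].
Proof.
split.
- move=> alpha beta [phi [phi_test /= -> ->]].
  rewrite /KL; case: asboolP => _; last exact: leey.
  exact: KL_bound_test.
- move=> alpha beta ha hb /(KL_bound_sqr ha hb).
  exact: Pinsker_bound_of_sqr.
- move=> kl2 alpha beta ha hb; apply: Pinsker_bound_of_sqr.
  by apply: le_trans kl2; rewrite lee_fin; nra.
Qed.
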